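(* Let $A, B \in M_4(\mathbb{C})$ satisfy $\operatorname{Tr}(A) = \operatorname{Tr}(B) = 0$ and $\|A\|_F^2 + \|B\|_F^2 = \frac{1}{4}$. Suppose that each of $A$ and $B$ is unitarily equivalent to a block-diagonal matrix with two $2\times 2$ diagonal blocks, i.e. there exist unitary $U, V \in M_4(\mathbb{C})$ and $A_{11}, A_{22}, B_{11}, B_{22} \in M_2(\mathbb{C})$ such that $UAU^* = \begin{bmatrix} A_{11} & 0 \\ 0 & A_{22}\end{bmatrix}$ and $VBV^* = \begin{bmatrix} B_{11} & 0 \\ 0 & B_{22}\end{bmatrix}$. Let $X = A \otimes I_4 + I_4 \otimes B \in M_{16}(\mathbb{C})$. Then $$\sigma_1(X)^2 + \sigma_2(X)^2 \leq \frac{1}{2},$$ where $\sigma_1(X) \ge \sigma_2(X)$ are the largest and second-largest singular values of $X$.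
   Context: $\|\cdot\|_F$ denotes the Frobenius norm, $\|A\|_F = (\operatorname{Tr}(A^*A))^{1/2}$. $\otimes$ denotes the Kronecker product. ''Unitarily equivalent'' is used in the sense $A \mapsto UAU^*$ with $U$ unitary. *)

(* Defs.v *)
(* Complex numbers: R[i] = complex R for an arbitrary real
   closed field R (covers C = Reals[i]). *)
From HB Require Import structures.
From mathcomp Require Import all_boot all_order all_algebra.
From mathcomp Require Import spectral.
From mathcomp.real_closed Require Export complex.
From mathcomp.real_closed Require mxtens.

Set Implicit Arguments.
Unset Strict Implicit.
Unset Printing Implicit Defensive.

Import Order.TTheory GRing.Theory Num.Theory.
Local Open Scope ring_scope.

Section Defs.
Variable C : numClosedFieldType.

Definition adjmx m n (A : 'M[C]_(m, n)) : 'M[C]_(n, m) := (map_mx Num.conj A)^T.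

Definition frob2 n (A : 'M[C]_n) : C := \tr (adjmx A *m A).

Definition unitary n (U : 'M[C]_n) : Prop := U *m adjmx U = 1%:M.

(* Kronecker product (row index (i,k) |-> i*p + k) *)
Definition kron m n p q (A : 'M[C]_(m, n)) (B : 'M[C]_(p, q))
  : 'M[C]_(m * p, n * q) := mxtens.tensmx A B.

(* eigenvalues of a square matrix, counted with algebraic multiplicity
   (the roots of its characteristic polynomial) *)
Definition eigvals n (A : 'M[C]_n) : seq C :=
  sval (closed_field_poly_normal (char_poly A)).

(* singular values of X, in nonincreasing order: square roots of the
   eigenvalues of X^* X (which are real and >= 0), sorted decreasingly *)
Definition singvals m n (X : 'M[C]_(m, n)) : seq C :=
  map sqrtC (sort (fun x y => y <= x) (eigvals (adjmx X *m X))).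

Definition sigma m n (X : 'M[C]_(m, n)) (k : nat) : C := nth 0 (singvals X) k.-1.

End Defs.

(* Main.v *)
Require Import Defs.
From HB Require Import structures.
From mathcomp Require Import all_boot all_order all_algebra.
From mathcomp.real_closed Require Import complex.
From mathcomp.real_closed Require mxtens.
From mathcomp Require Import spectral ring.
Import Order.TTheory GRing.Theory Num.Theory.
Local Open Scope ring_scope.

(* Identify C^4 (x) C^4 with 4x4 matrices W, so that X acts by
   W |-> A W + W B^T.  After rotating by U and V, this action preserves the four
   2x2 blocks W_ij, on which it is W_ij |-> A_ii W_ij + W_ij B_jj^T, and so does
   X^* X.  Take orthonormal eigenvectors W, Z of X^* X for sigma_1^2, sigma_2^2
   and a nonzero block W_p.  Either Z has a nonzero block Z_q with q <> p, and
   each squared singular value is bounded by the squared operator norm on its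
   block; or W_p and Z_p are orthogonal eigenvectors on the same block, and the
   sum is at most the squared Frobenius norm of that block.
   With A_ii = a + A', B_jj = b + B' and A', B' traceless, the operator norm is
   bounded through a singular value decomposition of W_ij and the Cauchy
   inequality |x + y + z|^2 <= |x|^2/u + |y|^2/v + |z|^2/w for u + v + w = 1. *)

Section KroneckerSum.
Set Implicit Arguments.
Unset Strict Implicit.
Variable C : numClosedFieldType.

(** * Adjoints, unitary matrices and the squared Frobenius norm *)

Lemma adjmxE m n (A : 'M[C]_(m, n)) i j : adjmx A i j = (A j i)^*.
Proof. by rewrite !mxE. Qed.

Lemma adjmxK m n (A : 'M[C]_(m, n)) : adjmx (adjmx A) = A.
Proof. by apply/matrixP => i j; rewrite !adjmxE conjCK. Qed.

Lemma adjmxM m n p (A : 'M[C]_(m, n)) (B : 'M[C]_(n, p)) :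
  adjmx (A *m B) = adjmx B *m adjmx A.
Proof. by rewrite /adjmx map_mxM trmx_mul. Qed.

Lemma adjmxD m n (A B : 'M[C]_(m, n)) : adjmx (A + B) = adjmx A + adjmx B.
Proof. by rewrite /adjmx map_mxD linearD. Qed.

Lemma adjmxB m n (A B : 'M[C]_(m, n)) : adjmx (A - B) = adjmx A - adjmx B.
Proof. by rewrite /adjmx map_mxB linearB. Qed.

Lemma adjmxZ m n a (A : 'M[C]_(m, n)) : adjmx (a *: A) = a^* *: adjmx A.
Proof. by rewrite /adjmx map_mxZ linearZ. Qed.

Lemma adjmx0 m n : adjmx 0 = 0 :> 'M[C]_(n, m).
Proof. by rewrite /adjmx map_mx0 trmx0. Qed.

Lemma adjmx1 n : adjmx 1%:M = 1%:M :> 'M[C]_n.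
Proof. by rewrite /adjmx map_mx1 trmx1. Qed.

Lemma adjmx_tr m n (A : 'M[C]_(m, n)) : adjmx A^T = (adjmx A)^T.
Proof. by apply/matrixP => i j; rewrite !mxE. Qed.

Lemma adjmx_block m1 m2 n1 n2 (A : 'M[C]_(m1, n1)) (B : 'M[C]_(m1, n2))
    (D : 'M[C]_(m2, n1)) (E : 'M[C]_(m2, n2)) :
  adjmx (block_mx A B D E)
  = block_mx (adjmx A) (adjmx D) (adjmx B) (adjmx E).
Proof. by rewrite /adjmx map_block_mx tr_block_mx. Qed.

Lemma adjmx_kron m n p q (A : 'M[C]_(m, n)) (B : 'M[C]_(p, q)) :
  adjmx (kron A B) = kron (adjmx A) (adjmx B).
Proof. by apply/matrixP => i j; rewrite !mxE rmorphM. Qed.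

Lemma mxtrace_adj n (A : 'M[C]_n) : \tr (adjmx A) = (\tr A)^*.
Proof.
by rewrite /adjmx mxtrace_tr rmorph_sum; apply: eq_bigr => i _; rewrite mxE.
Qed.

Lemma unitaryV n (U : 'M[C]_n) : unitary U -> adjmx U *m U = 1%:M.
Proof. exact: mulmx1C. Qed.

Lemma unitary_adj n (U : 'M[C]_n) : unitary U -> unitary (adjmx U).
Proof. by move=> uU; rewrite /unitary adjmxK unitaryV. Qed.

Lemma unitary_mx n (U : 'M[C]_n) : U \is unitarymx -> unitary U.
Proof. by move=> /unitarymxP uU; rewrite /unitary /adjmx map_trmx. Qed.

Lemma mxdotE m n (A B : 'M[C]_(m, n)) :
  \tr (adjmx A *m B) = \sum_i \sum_j (A i j)^* * B i j.
Proof.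
rewrite exchange_big; apply: eq_bigr => j _; rewrite mxE.
by apply: eq_bigr => i _; rewrite adjmxE.
Qed.

Lemma frob2E n (A : 'M[C]_n) : frob2 A = \sum_i \sum_j `|A i j| ^+ 2.
Proof.
rewrite /frob2 mxdotE; apply: eq_bigr => i _; apply: eq_bigr => j _.
by rewrite normCKC.
Qed.

Lemma frob2_ge0 n (A : 'M[C]_n) : 0 <= frob2 A.
Proof.
rewrite frob2E; apply: sumr_ge0 => i _; apply: sumr_ge0 => j _.
exact: exprn_ge0.
Qed.

Lemma frob2_eq0 n (A : 'M[C]_n) : (frob2 A == 0) = (A == 0).
Proof.
apply/idP/eqP => [|->]; last by rewrite /frob2 mulmx0 mxtrace0.
rewrite frob2E psumr_eq0 => [/allP A0|i _]; last first.
  by apply: sumr_ge0 => j _; apply: exprn_ge0.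
apply/matrixP => i j; have /= := A0 i (mem_index_enum _).
rewrite psumr_eq0 => [/allP/(_ j (mem_index_enum _)) /=|k _]; last exact: exprn_ge0.
by rewrite mxE sqrf_eq0 normr_eq0 => /eqP.
Qed.

Lemma frob2_gt0 n (A : 'M[C]_n) : A != 0 -> 0 < frob2 A.
Proof. by move=> A0; rewrite lt0r frob2_eq0 A0 frob2_ge0. Qed.

Lemma frob2_tr n (A : 'M[C]_n) : frob2 A^T = frob2 A.
Proof.
rewrite !frob2E exchange_big; apply: eq_bigr => i _; apply: eq_bigr => j _.
by rewrite mxE.
Qed.

Lemma frob2Z n a (A : 'M[C]_n) : frob2 (a *: A) = `|a| ^+ 2 * frob2 A.
Proof.
by rewrite /frob2 adjmxZ -scalemxAl -scalemxAr scalerA mxtraceZ -normCKC.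
Qed.

Lemma frob2_block_diag m n (A : 'M[C]_m) (D : 'M[C]_n) :
  frob2 (block_mx A 0 0 D) = frob2 A + frob2 D.
Proof.
rewrite /frob2 adjmx_block mulmx_block mxtrace_block.
by rewrite !adjmx0 !mulmx0 addr0 add0r.
Qed.

Lemma frob2_mul_unitary n (U A V : 'M[C]_n) :
  unitary U -> unitary V -> frob2 (U *m A *m V) = frob2 A.
Proof.
move=> uU uV; rewrite /frob2 !adjmxM -!mulmxA (mulmxA (adjmx U)) unitaryV //.
by rewrite mul1mx mxtrace_mulC -!mulmxA uV mulmx1.
Qed.

Lemma mxtrace_conj_unitary n (U A : 'M[C]_n) :
  unitary U -> \tr (U *m A *m adjmx U) = \tr A.
Proof. by move=> uU; rewrite mxtrace_mulC mulmxA unitaryV ?mul1mx. Qed.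

(** * Spectral theorem for Hermitian matrices, and singular values *)

Lemma unitary_diag n (H : 'M[C]_n) : adjmx H = H ->
  exists S (d : 'rV_n), unitary S /\ H = adjmx S *m diag_mx d *m S.
Proof.
move=> adjH; have /orthomx_spectralP : H \is normalmx.
  by apply/normalmxP; rewrite -map_trmx -/(adjmx H) adjH.
have := spectral_unitarymx H; set S := spectralmx H => uS.
rewrite invmx_unitary // -map_trmx -/(adjmx S) => eH.
by exists S, (spectral_diag H); split=> //; apply: unitary_mx.
Qed.

(** Unitary conjugation leaves the characteristic polynomial unchanged, and a product of monic
    linear factors determines its roots up to order. The order in [eigvals] is that of a chosen
    factorisation, hence [perm_eq]. *)
Lemma eigvals_unitary_diag n (S : 'M[C]_n) (d : 'rV_n) : unitary S ->
  perm_eq (eigvals (adjmx S *m diag_mx d *m S)) [seq d 0 i | i <- enum 'I_n].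
Proof.
move=> uS; rewrite /eigvals; case: closed_field_poly_normal => s /=.
rewrite (monicP (char_poly_monic _)) scale1r => es; apply: prod_XsubC_eq.
rewrite big_map big_enum -es /char_poly /=.
have -> : char_poly_mx (adjmx S *m diag_mx d *m S)
    = map_mx polyC (adjmx S) *m char_poly_mx (diag_mx d) *m map_mx polyC S.
  rewrite /char_poly_mx !map_mxM mulmxBr mulmxBl; congr (_ - _).
  by rewrite mul_mx_scalar -scalemxAl -map_mxM unitaryV // map_mx1 scalemx1.
rewrite !det_mulmx mulrAC -det_mulmx -map_mxM unitaryV // map_mx1 det1 mul1r.
rewrite -/(char_poly _) char_poly_trig ?diag_mx_is_trig //.
by apply: eq_bigr => i _; rewrite mxE eqxx mulr1n.
Qed.

(** After diagonalising [H], sorting only permutes the diagonal, so both squared singular values sit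
    at diagonal positions, and the matching columns of [adjmx S] are the eigenvectors. *)
Lemma sigma_eigenvectors n (X : 'M[C]_n) : (1 < n)%N ->
  let H := adjmx X *m X in
  exists u v : 'cV[C]_n,
    [/\ \tr (adjmx u *m u) = 1, \tr (adjmx v *m v) = 1,
        \tr (adjmx u *m v) = 0,
        H *m u = sigma X 1 ^+ 2 *: u & H *m v = sigma X 2 ^+ 2 *: v].
Proof.
move=> n1 H; have [|S [d [uS eH]]] := @unitary_diag n H.
  by rewrite adjmxM adjmxK.
have := eigvals_unitary_diag d uS; rewrite -eH.
set t := [seq _ | _ <- _]; rewrite -(perm_sort (fun x y => y <= x)).
have st : size t = n by rewrite size_map size_enum_ord.
(* Positions are extracted rather than values: they stay distinct even when the two largest
   eigenvalues coincide, which gives orthogonality. *)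
move=> /(perm_iotaP 0); rewrite st => -[Is pIs es].
have := perm_uniq pIs; have := perm_size pIs; have := perm_mem pIs.
rewrite iota_uniq size_iota.
(* [Is] has length [n > 1], so neither [sigma X 1] nor [sigma X 2] is the default value of [nth]. *)
case: Is es {pIs} => [|k [|l Is]] es mIs => [n0|n0|_]; try by rewrite -n0 in n1.
rewrite /= inE negb_or => /andP[/andP[kl _] _].
have kn : (k < n)%N by have := mIs k; rewrite mem_iota !inE eqxx => /esym/andP[].
have ln : (l < n)%N by have := mIs l; rewrite mem_iota !inE eqxx orbT => /esym/andP[].
have tE (i : 'I_n) : nth 0 t i = d 0 i.
  by rewrite (nth_map i) ?size_enum_ord // nth_ord_enum.
have s1 : sigma X 1 ^+ 2 = d 0 (Ordinal kn).
  by rewrite /sigma /singvals es /= sqrtCK -tE.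
have s2 : sigma X 2 ^+ 2 = d 0 (Ordinal ln).
  by rewrite /sigma /singvals es /= sqrtCK -tE.
pose e i := adjmx S *m delta_mx i 0 : 'cV[C]_n.
have dot i j : \tr (adjmx (e i) *m e j) = (i == j)%:R.
  rewrite adjmxM adjmxK -mulmxA (mulmxA S) uS mul1mx.
  rewrite /adjmx map_delta_mx trmx_delta mul_delta_mx_cond raddfMn /=.
  by rewrite /mxtrace big_ord1 !mxE !eqxx.
have eig i : H *m e i = d 0 i *: e i.
  rewrite eH /e -!mulmxA (mulmxA S) uS mul1mx scalemxAr; congr (_ *m _).
  apply/matrixP => a z; rewrite mul_diag_mx !mxE.
  by case: (a =P i) => [->|_] //=; rewrite !mulr0.
exists (e (Ordinal kn)), (e (Ordinal ln)).
by rewrite !dot !eqxx s1 s2 !eig -val_eqE /= (negPf kl).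
Qed.

(** * The Kronecker sum as an operator on matrices *)

Definition ksum m n (A : 'M[C]_m) (B : 'M[C]_n) : 'M[C]_(m * n) :=
  kron A 1%:M + kron 1%:M B.

Definition sylv m n (A : 'M[C]_m) (B : 'M[C]_n) (W : 'M[C]_(m, n)) :=
  A *m W + W *m B^T.

(* Row-major, so that it matches the row indexing of [kron]. *)
Definition vecm m n (W : 'M[C]_(m, n)) : 'cV[C]_(m * n) :=
  \col_k W (mxtens.mxtens_unindex k).1 (mxtens.mxtens_unindex k).2.

Definition unvecm m n (u : 'cV[C]_(m * n)) : 'M[C]_(m, n) :=
  \matrix_(i, j) u (mxtens.mxtens_index (i, j)) 0.

Lemma unvecmK m n (u : 'cV[C]_(m * n)) : vecm (unvecm u) = u.
Proof.
apply/matrixP => k l; rewrite !mxE (ord1 l).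
by rewrite -surjective_pairing mxtens.mxtens_unindexK.
Qed.

Lemma vecmK m n (W : 'M[C]_(m, n)) : unvecm (vecm W) = W.
Proof. by apply/matrixP => i j; rewrite !mxE mxtens.mxtens_indexK. Qed.

Lemma vecmZ m n a (W : 'M[C]_(m, n)) : vecm (a *: W) = a *: vecm W.
Proof. by apply/matrixP => i j; rewrite !mxE. Qed.

Lemma sum_mxtens m n (F : 'I_(m * n) -> C) :
  \sum_k F k = \sum_i \sum_j F (mxtens.mxtens_index (i, j)).
Proof.
rewrite pair_big /= (reindex (@mxtens.mxtens_index m n)) /=.
  by apply: eq_bigr => -[].
by exists (@mxtens.mxtens_unindex m n) => k _;
  rewrite (mxtens.mxtens_indexK, mxtens.mxtens_unindexK).
Qed.

(** In each Kronecker product the identity factor collapses one of the two sums over row and column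
    indices; what remains is a matrix product on the left, or on the right by the transpose. *)
Lemma ksum_vecm m n (A : 'M[C]_m) (B : 'M[C]_n) W :
  ksum A B *m vecm W = vecm (sylv A B W).
Proof.
apply/matrixP => k l; case: (mxtens.mxtens_indexP k) => i j.
rewrite mulmxDl !mxE !mxtens.mxtens_indexK /=; congr (_ + _).
  rewrite sum_mxtens; apply: eq_bigr => a _.
  rewrite (bigD1 j) //= !mxE !mxtens.mxtens_indexK /= eqxx mulr1.
  rewrite big1 ?addr0 // => b /negPf bj.
  by rewrite !mxE !mxtens.mxtens_indexK /= eq_sym bj mulr0 mul0r.
rewrite sum_mxtens (bigD1 i) //= [X in _ + X]big1 ?addr0.
  apply: eq_bigr => b _.
  by rewrite !mxE !mxtens.mxtens_indexK /= eqxx mul1r mulrC.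
move=> a /negPf ai; rewrite big1 // => b _.
by rewrite !mxE !mxtens.mxtens_indexK /= eq_sym ai !mul0r.
Qed.

Lemma mxdot_vecm m n (W Z : 'M[C]_(m, n)) :
  \tr (adjmx (vecm W) *m vecm Z) = \tr (adjmx W *m Z).
Proof.
rewrite !mxdotE sum_mxtens; apply: eq_bigr => i _; apply: eq_bigr => j _.
by rewrite big_ord1 !mxE mxtens.mxtens_indexK.
Qed.

Lemma adjmx_ksum m n (A : 'M[C]_m) (B : 'M[C]_n) :
  adjmx (ksum A B) = ksum (adjmx A) (adjmx B).
Proof. by rewrite adjmxD !adjmx_kron !adjmx1. Qed.

(** The eigenvector equation of [X^* X] for [X = ksum A B], read on matrices. *)
Definition sylv_eigen m n (A : 'M[C]_m) (B : 'M[C]_n) l W :=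
  sylv (adjmx A) (adjmx B) (sylv A B W) = l *: W.

Lemma ksum_eigen m n (A : 'M[C]_m) (B : 'M[C]_n) l (u : 'cV[C]_(m * n)) :
  adjmx (ksum A B) *m ksum A B *m u = l *: u -> sylv_eigen A B l (unvecm u).
Proof.
move=> /(congr1 (@unvecm m n)).
rewrite -{1}[u]unvecmK -mulmxA adjmx_ksum !ksum_vecm vecmK.
rewrite /sylv_eigen => ->.
by rewrite -{1}[u]unvecmK -vecmZ vecmK.
Qed.

(** For the trace inner product, [sylv (adjmx A) (adjmx B)] is the adjoint of [sylv A B]; the
    squared norm of the image is therefore the inner product of [W] with [l *: W]. *)
Lemma sylv_eigen_frob2 n (A B : 'M[C]_n) l W :
  sylv_eigen A B l W -> frob2 (sylv A B W) = l * frob2 W.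
Proof.
have adj (Z : 'M[C]_n) : \tr (adjmx (sylv A B W) *m Z)
    = \tr (adjmx W *m sylv (adjmx A) (adjmx B) Z).
  rewrite /sylv adjmxD !adjmxM mulmxDl mulmxDr !mxtraceD mulmxA; congr (_ + _).
  by rewrite -mulmxA mxtrace_mulC adjmx_tr mulmxA.
by move=> e; rewrite /frob2 adj e -scalemxAr mxtraceZ.
Qed.

(** The map [W |-> U W V^T] intertwines the two operators. The transpose of [V] occurs because [B]
    acts on the right through [B^T]. *)
Lemma sylv_eigen_unitary m n (U : 'M[C]_m) (V : 'M[C]_n) A B l W :
  unitary U -> unitary V -> sylv_eigen A B l W ->
  sylv_eigen (U *m A *m adjmx U) (V *m B *m adjmx V) l (U *m W *m V^T).
Proof.
move=> uU uV.
have key A1 B1 Z : sylv (U *m A1 *m adjmx U) (V *m B1 *m adjmx V) (U *m Z *m V^T)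
    = U *m sylv A1 B1 Z *m V^T.
  rewrite /sylv mulmxDr mulmxDl; congr (_ + _).
    by rewrite -!mulmxA (mulmxA (adjmx U)) unitaryV ?mul1mx.
  have VV : V^T *m (adjmx V)^T = 1%:M by rewrite -trmx_mul unitaryV ?trmx1.
  by rewrite !trmx_mul -!mulmxA (mulmxA V^T) VV mul1mx.
rewrite /sylv_eigen => e.
by rewrite !adjmxM !adjmxK !mulmxA !key e -scalemxAr -scalemxAl.
Qed.

(** * Frobenius norm of the Kronecker sum, and Bessel's inequality *)

Lemma frob2_ksum m n (A : 'M[C]_m) (B : 'M[C]_n) :
  frob2 (ksum A B) = n%:R * frob2 A + m%:R * frob2 B
    + ((\tr A)^* * \tr B + \tr A * (\tr B)^*).
Proof.
have tr_kron (D : 'M[C]_m) (E : 'M[C]_n) : \tr (kron D E) = \tr D * \tr E.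
  rewrite /mxtrace sum_mxtens mulr_suml; apply: eq_bigr => i _.
  by rewrite mulr_sumr; apply: eq_bigr => j _; rewrite mxtens.tensmxE.
rewrite /frob2 adjmx_ksum mulmxDl !mulmxDr /kron !mxtens.tensmx_mul.
rewrite !mul1mx !mulmx1 !mxtraceD !tr_kron !mxtrace1 !mxtrace_adj.
by rewrite [X in _ + X]addrC addrACA (mulrC _ n%:R).
Qed.

(** With [P] the orthogonal projection onto the span of [u] and [v], and [T] its complement, the gap
    between the two sides is [frob2 (Y *m T)]. *)
Lemma frob2_bessel n (Y : 'M[C]_n) (u v : 'cV[C]_n) :
    \tr (adjmx u *m u) = 1 -> \tr (adjmx v *m v) = 1 ->
    \tr (adjmx u *m v) = 0 ->
  \tr (adjmx (Y *m u) *m (Y *m u)) + \tr (adjmx (Y *m v) *m (Y *m v))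
  <= frob2 Y.
Proof.
have e11 (M : 'M[C]_1) a : \tr M = a -> M = a%:M.
  by rewrite /mxtrace big_ord1 => <-; apply: mx11_scalar.
move=> /e11 uu /e11 vv /e11 uv.
rewrite raddf0 in uv.
have vu : adjmx v *m u = 0 by rewrite -[_ *m _]adjmxK adjmxM adjmxK uv adjmx0.
pose P := u *m adjmx u + v *m adjmx v.
have adjP : adjmx P = P by rewrite /P adjmxD !adjmxM !adjmxK.
have PP : P *m P = P.
  rewrite /P mulmxDl !mulmxDr -!mulmxA !(mulmxA (adjmx _)) uu vv uv vu.
  by rewrite !(mul1mx, mul0mx, mulmx0) addr0 add0r.
have trP (w : 'cV[C]_n) :
    \tr (adjmx (Y *m w) *m (Y *m w)) = \tr (adjmx Y *m Y *m (w *m adjmx w)).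
  by rewrite adjmxM [in RHS]mulmxA [in RHS]mxtrace_mulC !mulmxA.
pose T := 1%:M - P.
have TT : T *m T = T.
  by rewrite /T mulmxBl mul1mx mulmxBr mulmx1 PP subrr subr0.
have adjT : adjmx T = T by rewrite adjmxB adjmx1 adjP.
have YT : frob2 (Y *m T) = \tr (adjmx Y *m Y *m T).
  rewrite /frob2 adjmxM adjT mxtrace_mulC mulmxA -(mulmxA Y) TT.
  by rewrite mxtrace_mulC mulmxA.
have := frob2_ge0 (Y *m T).
rewrite YT /T mulmxBr mulmx1 raddfB subr_ge0 /=.
by rewrite mulmxDr mxtraceD -!trP.
Qed.

(** * Scalar inequalities and the singular value decomposition in dimension two *)

Lemma sum_ord2 (V : nmodType) (F : 'I_2 -> V) : \sum_i F i = F 0 + F 1.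
Proof.
by rewrite !big_ord_recl big_ord0 addr0; congr (F _ + F _); apply: val_inj.
Qed.

Lemma ord2_ind (P : 'I_2 -> Prop) : P 0 -> P 1 -> forall i, P i.
Proof.
move=> P0 P1 [[|[|//]] p]; [move: P0|move: P1]; congr P; exact: val_inj.
Qed.

Lemma sqr_norm_parallelogram (x y : C) :
  `|x + y| ^+ 2 + `|x - y| ^+ 2 = 2 * `|x| ^+ 2 + 2 * `|y| ^+ 2.
Proof. rewrite !normCK rmorphB rmorphD /=; ring. Qed.

Lemma sqr_normD_le (x y : C) :
  `|x + y| ^+ 2 <= 2 * `|x| ^+ 2 + 2 * `|y| ^+ 2.
Proof. by rewrite -sqr_norm_parallelogram lerDl exprn_ge0. Qed.

(** Cauchy's inequality with weights 1/2, 1/4, 1/4, from two uses of the two-term bound. *)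
Lemma sqr_normD3_le (x y z : C) :
  `|x + y + z| ^+ 2 <= 2 * `|x| ^+ 2 + 4 * `|y| ^+ 2 + 4 * `|z| ^+ 2.
Proof.
rewrite -addrA; apply: le_trans (sqr_normD_le _ _) _.
rewrite -addrA lerD2l -[4]/((2 * 2)%:R) natrM -!mulrA -mulrDr.
by rewrite ler_pM2l ?ltr0n // sqr_normD_le.
Qed.

(** Lagrange's identity writes the gap between the two sides as a squared modulus. *)
Lemma sqr_norm_cauchy (x y s t : C) :
  `|x * s + y * t| ^+ 2
  <= (`|x| ^+ 2 + `|y| ^+ 2) * (`|s| ^+ 2 + `|t| ^+ 2).
Proof.
rewrite -subr_ge0.
suff -> : (`|x| ^+ 2 + `|y| ^+ 2) * (`|s| ^+ 2 + `|t| ^+ 2)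
    - `|x * s + y * t| ^+ 2 = `|x * t^* - y * s^*| ^+ 2 by exact: exprn_ge0.
rewrite !normCK rmorphB rmorphD !rmorphM /= !conjCK; ring.
Qed.

Lemma unit_vector (x y : C) : (x != 0) || (y != 0) ->
  exists k, `|k * x| ^+ 2 + `|k * y| ^+ 2 = 1.
Proof.
move=> xy0; have N0 : 0 < `|x| ^+ 2 + `|y| ^+ 2.
  rewrite lt0r addr_ge0 ?exprn_ge0 // andbT paddr_eq0 ?exprn_ge0 //.
  by rewrite !sqrf_eq0 !normr_eq0; rewrite -negb_and in xy0.
set N := _ + _ in N0; exists (sqrtC N)^-1.
have k2 : `|(sqrtC N)^-1| ^+ 2 = N^-1.
  by rewrite normfV exprVn ger0_norm ?sqrtCK // sqrtC_ge0 ltW.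
by rewrite !normrM !exprMn -mulrDr k2 mulVf // gt_eqF.
Qed.

Lemma orthogonal_columns_diag (W : 'M[C]_2) : (adjmx W *m W) 0 1 = 0 ->
  exists2 P, unitary P & (P *m W) 0 1 = 0 /\ (P *m W) 1 0 = 0.
Proof.
rewrite !mxE sum_ord2 !adjmxE => orth.
suff [r [t [rt e01 e10]]] : exists r t : C, [/\ `|r| ^+ 2 + `|t| ^+ 2 = 1,
    r^* * W 0 1 + t^* * W 1 1 = 0 & - t * W 0 0 + r * W 1 0 = 0].
  pose P : 'M[C]_2 := \matrix_(i, j)
    if i == 0 then (if j == 0 then r else t)^* else if j == 0 then - t else r.
  exists P; last by rewrite !mxE !sum_ord2 !mxE /=.
  have rt' : r^* * r + t^* * t = 1 by rewrite -rt !normCKC.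
  apply/matrixP; elim/ord2_ind; elim/ord2_ind; rewrite !mxE sum_ord2 !mxE /=.
  - by rewrite !conjCK.
  - by rewrite rmorphN /=; ring.
  - by rewrite !conjCK; ring.
  - by rewrite rmorphN /= -rt'; ring.
(* A nonzero first column is normalised; failing that, a unit vector orthogonal to a nonzero second
   column serves; for [W = 0] any unit vector does. *)
have [/unit_vector[k e]|] := boolP ((W 0 0 != 0) || (W 1 0 != 0)).
  exists (k * W 0 0), (k * W 1 0); split=> //; last by ring.
  by rewrite !rmorphM /= -!mulrA -mulrDr orth mulr0.
rewrite negb_or !negbK => /andP[/eqP x0 /eqP y0].
have [/unit_vector[k e]|] := boolP ((- (W 1 1)^* != 0) || ((W 0 1)^* != 0)).
  exists (k * - (W 1 1)^*), (k * (W 0 1)^*); split=> //.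
    by rewrite !rmorphM /= rmorphN /= !conjCK; ring.
  by rewrite x0 y0 !mulr0 addr0.
rewrite oppr_eq0 !conjC_eq0 negb_or !negbK => /andP[_ /eqP y1].
exists 1, 0; rewrite normr1 normr0 expr1n expr0n addr0 x0 y0 y1 !mulr0 addr0.
by rewrite rmorph0 mul0r add0r.
Qed.

(** If [Q] diagonalises [V^* V], the columns of [V Q] are orthogonal, and a unitary on the left then
    makes [V Q] diagonal. *)
Lemma svd2 (V : 'M[C]_2) : exists P Q, [/\ unitary P, unitary Q,
  (P *m V *m Q) 0 1 = 0 & (P *m V *m Q) 1 0 = 0].
Proof.
have [|S [d [uS eH]]] := @unitary_diag _ (adjmx V *m V).
  by rewrite adjmxM adjmxK.
pose Q := adjmx S; have uQ : unitary Q by exact: unitary_adj.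
have [|P uP [e01 e10]] := @orthogonal_columns_diag (V *m Q).
  rewrite adjmxM -mulmxA (mulmxA (adjmx V)) eH /Q adjmxK !mulmxA uS.
  by rewrite mul1mx -mulmxA uS mulmx1 !mxE.
by exists P, Q; rewrite -mulmxA.
Qed.

Lemma frob2_2 (A : 'M[C]_2) : frob2 A =
  `|A 0 0| ^+ 2 + `|A 0 1| ^+ 2 + (`|A 1 0| ^+ 2 + `|A 1 1| ^+ 2).
Proof. by rewrite frob2E !sum_ord2. Qed.

Lemma mxtrace0_2 (A : 'M[C]_2) : \tr A = 0 -> A 1 1 = - A 0 0.
Proof. by rewrite /mxtrace sum_ord2 addrC => /eqP; rewrite addr_eq0 => /eqP. Qed.

(** * Norm bound for the action on one block *)

Section Weighted.
Variables p q r : C.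
Hypotheses (q1 : 1 <= q) (r1 : 1 <= r).
(** This is applied with [(p, q, r)] equal to [(4, 1, 2)], [(4, 2, 1)] and [(2, 2, 2)], where
    [1/p + 1/(2q) + 1/(2r) = 1]. The bounds [1 <= q] and [1 <= r] absorb the off-diagonal terms,
    whose own Cauchy inequality has coefficient one. *)
Hypothesis cauchy : forall x y z : C,
  `|x + y + z| ^+ 2 <= p * `|x| ^+ 2 + 2 * q * `|y| ^+ 2 + 2 * r * `|z| ^+ 2.

(* The diagonal entries of [A] and [B] add up with [c], the off-diagonal ones
   only with each other: hence the two Cauchy inequalities. *)
Lemma frob2_sylv_diag c (A B D : 'M[C]_2) : \tr A = 0 -> \tr B = 0 ->
  D 0 1 = 0 -> D 1 0 = 0 ->
  frob2 (c *: D + A *m D + D *m B)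
  <= (p * `|c| ^+ 2 + q * frob2 A + r * frob2 B) * frob2 D.
Proof.
move=> /mxtrace0_2 A11 /mxtrace0_2 B11 D01 D10.
rewrite !frob2_2 !mxE !sum_ord2 A11 B11 D01 D10 !(mulr0, mul0r, addr0, add0r).
rewrite !normrN normr0 expr0n addr0 add0r.
move: (A 0 0) (A 0 1) (A 1 0) (B 0 0) (B 0 1) (B 1 0) (D 0 0) (D 1 1).
move=> {A B D A11 B11 D01 D10} a x y b z w s t.
(* The diagonals of the traceless matrices are [(a, -a)] and [(b, -b)], so [2 * q] and [2 * r] are
   exactly the coefficients that [q * frob2 A] and [r * frob2 B] supply. *)
pose K := p * `|c| ^+ 2 + 2 * q * `|a| ^+ 2 + 2 * r * `|b| ^+ 2.
have e00 : `|c * s + a * s + s * b| ^+ 2 <= K * `|s| ^+ 2.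
  rewrite (mulrC s) -!mulrDl normrM exprMn.
  by apply: ler_wpM2r; rewrite ?exprn_ge0.
have e11 : `|c * t + - a * t + t * - b| ^+ 2 <= K * `|t| ^+ 2.
  rewrite (mulrC t) -!mulrDl normrM exprMn.
  apply: ler_wpM2r; rewrite ?exprn_ge0 //.
  by apply: le_trans (cauchy _ _ _) _; rewrite !normrN.
have e01 : `|x * t + s * z| ^+ 2
    <= (q * `|x| ^+ 2 + r * `|z| ^+ 2) * (`|s| ^+ 2 + `|t| ^+ 2).
  rewrite (mulrC s) (addrC (`|s| ^+ 2)); apply: le_trans (sqr_norm_cauchy _ _ _ _) _.
  apply: ler_wpM2r; first by rewrite addr_ge0 ?exprn_ge0.
  by apply: lerD; rewrite ler_peMl ?exprn_ge0.
have e10 : `|y * s + t * w| ^+ 2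
    <= (q * `|y| ^+ 2 + r * `|w| ^+ 2) * (`|s| ^+ 2 + `|t| ^+ 2).
  rewrite (mulrC t); apply: le_trans (sqr_norm_cauchy _ _ _ _) _.
  apply: ler_wpM2r; first by rewrite addr_ge0 ?exprn_ge0.
  by apply: lerD; rewrite ler_peMl ?exprn_ge0.
apply: le_trans (lerD (lerD e00 e01) (lerD e10 e11)) _.
rewrite le_eqVlt; apply/orP; left; apply/eqP; rewrite /K; ring.
Qed.

(** The singular value decomposition of [V] reduces to the diagonal case: it conjugates [A] and [B]
    by unitaries, which preserves traces and Frobenius norms. *)
Lemma frob2_sylv_le c (A B V : 'M[C]_2) : \tr A = 0 -> \tr B = 0 ->
  frob2 (c *: V + A *m V + V *m B)
  <= (p * `|c| ^+ 2 + q * frob2 A + r * frob2 B) * frob2 V.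
Proof.
move=> trA trB; have [P [Q [uP uQ d01 d10]]] := svd2 V.
have PP := unitaryV uP; have uP' := unitary_adj uP; have uQ' := unitary_adj uQ.
have := @frob2_sylv_diag c (P *m A *m adjmx P) (adjmx Q *m B *m Q) _ _ _ d01 d10.
rewrite mxtrace_conj_unitary // -{2}[Q]adjmxK mxtrace_conj_unitary //.
rewrite !frob2_mul_unitary // => /(_ trA trB).
rewrite -[X in frob2 X <= _ -> _](_ : P *m (c *: V + A *m V + V *m B) *m Q = _).
  by rewrite frob2_mul_unitary.
rewrite !mulmxDr !mulmxDl -!scalemxAr -!scalemxAl; congr (_ + _ + _).
  by rewrite -!mulmxA (mulmxA (adjmx P)) PP mul1mx.
by rewrite -!mulmxA (mulmxA Q (adjmx Q)) uQ mul1mx.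
Qed.

End Weighted.

(** * Eigenvalue bounds through scalar and traceless parts *)

Definition mean (A : 'M[C]_2) : C := \tr A / 2.
Definition dev (A : 'M[C]_2) : C := frob2 (A - (mean A)%:M).

Lemma mxtrace_mean A : \tr A = 2 * mean A.
Proof. by rewrite mulrC divfK // pnatr_eq0. Qed.

Lemma dev_ge0 A : 0 <= dev A.
Proof. exact: frob2_ge0. Qed.

(** Pythagoras: the scalar and traceless parts are orthogonal, and the identity has squared norm
    2. *)
Lemma frob2_dev A : frob2 A = 2 * `|mean A| ^+ 2 + dev A.
Proof.
rewrite /dev {2}/frob2 adjmxB mulmxBl !mulmxBr !raddfB /= -/(frob2 A).
have -> : adjmx (mean A)%:M = ((mean A)^*)%:M :> 'M_2.
  by rewrite /adjmx map_scalar_mx tr_scalar_mx.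
rewrite mul_mx_scalar !mul_scalar_mx !mxtraceZ mxtrace_scalar mxtrace_adj.
rewrite mxtrace_mean normCK; move: (mean A) => a.
by rewrite rmorphM /= conjC_nat; ring.
Qed.

(** The eigenvalue is the quotient [frob2 (sylv A B W) / frob2 W]. Splitting off the scalar parts of
    [A] and [B] turns [sylv A B W] into the form bounded by [frob2_sylv_le]. *)
Lemma sylv_eigen_le (p q r : C) (A B W : 'M[C]_2) l :
    1 <= q -> 1 <= r ->
    (forall x y z : C, `|x + y + z| ^+ 2
       <= p * `|x| ^+ 2 + 2 * q * `|y| ^+ 2 + 2 * r * `|z| ^+ 2) ->
    W != 0 -> sylv_eigen A B l W ->
  l <= p * `|mean A + mean B| ^+ 2 + q * dev A + r * dev B.
Proof.
move=> q1 r1 cauchy W0 /sylv_eigen_frob2 eW.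
rewrite -(ler_pM2r (frob2_gt0 W0)) -eW.
have tr0 (D : 'M[C]_2) : \tr (D - (mean D)%:M) = 0.
  by rewrite raddfB /= mxtrace_scalar mxtrace_mean mulr_natl subrr.
have trT : \tr (B - (mean B)%:M)^T = 0 by rewrite mxtrace_tr.
have := frob2_sylv_le q1 r1 cauchy (mean A + mean B) W (tr0 A) trT.
rewrite frob2_tr; congr (frob2 _ <= _).
rewrite /sylv raddfB /= tr_scalar_mx mulmxBl mulmxBr mul_scalar_mx mul_mx_scalar.
by rewrite scalerDl -addrA addrACA !subrKC.
Qed.

(* By Bessel's inequality, two orthonormal vectors see at most the squared
   Frobenius norm of the whole Kronecker sum. *)
Lemma sylv_eigen_pair_le (A B W1 W2 : 'M[C]_2) l1 l2 :
    W1 != 0 -> W2 != 0 -> \tr (adjmx W1 *m W2) = 0 ->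
    sylv_eigen A B l1 W1 -> sylv_eigen A B l2 W2 ->
  l1 + l2 <= 4 * `|mean A + mean B| ^+ 2 + 2 * dev A + 2 * dev B.
Proof.
have normalize (W : 'M[C]_2) l : W != 0 -> sylv_eigen A B l W ->
    exists k, let u := vecm (k *: W) in
      \tr (adjmx u *m u) = 1
      /\ \tr (adjmx (ksum A B *m u) *m (ksum A B *m u)) = l.
  move=> W0 eW; have f0 := frob2_gt0 W0.
  exists (sqrtC (frob2 W))^-1 => u; have k2 : `|(sqrtC (frob2 W))^-1| ^+ 2 * frob2 W = 1.
    rewrite normfV exprVn ger0_norm ?sqrtC_ge0 ?(ltW f0) // sqrtCK.
    by rewrite mulVf // gt_eqF.
  rewrite ksum_vecm !mxdot_vecm -!/(frob2 _) frob2Z k2; split=> //.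
  rewrite (_ : sylv A B _ = (sqrtC (frob2 W))^-1 *: sylv A B W).
    by rewrite frob2Z (sylv_eigen_frob2 eW) mulrCA k2 mulr1.
  by rewrite /sylv -scalemxAr -scalemxAl scalerDr.
move=> W1_0 W2_0 orth /(normalize _ _ W1_0)[k1 [u1 <-]].
move=> /(normalize _ _ W2_0)[k2 [u2 <-]].
apply: le_trans (frob2_bessel _ u1 u2 _) _.
  rewrite mxdot_vecm adjmxZ -scalemxAl -scalemxAr !mxtraceZ orth.
  by rewrite !mulr0.
(* This last step is an equality: the trace cross terms complete the square in [|a + b|^2]. *)
rewrite frob2_ksum !frob2_dev !mxtrace_mean le_eqVlt; apply/orP; left.
apply/eqP; move: (mean A) (mean B) => a b.
by rewrite !normCK !rmorphM /= conjC_nat rmorphD /=; ring.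
Qed.

(** Indexing by [bool] lets [~~ i] name the other block, so one argument covers every position of a
    nonzero block of [W1]. The trace conditions make the two means of each family opposite. *)
Lemma two_blocks_le (A B : bool -> 'M[C]_2) (W1 W2 : bool -> bool -> 'M[C]_2)
    l1 l2 :
    \tr (A true) + \tr (A false) = 0 -> \tr (B true) + \tr (B false) = 0 ->
    (forall i j, sylv_eigen (A i) (B j) l1 (W1 i j)) ->
    (forall i j, sylv_eigen (A i) (B j) l2 (W2 i j)) ->
    (exists i j, W1 i j != 0) -> (exists i j, W2 i j != 0) ->
    \sum_i \sum_j \tr (adjmx (W1 i j) *m W2 i j) = 0 ->
  l1 + l2 <= 2 * (frob2 (A true) + frob2 (A false)
                  + (frob2 (B true) + frob2 (B false))).
Proof.
move=> trA trB e1 e2 [i [j W1ij]] W2_0 orth.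
have opp (D : bool -> 'M[C]_2) k : \tr (D true) + \tr (D false) = 0 ->
    mean (D (~~ k)) = - mean (D k).
  by move=> /eqP; rewrite addr_eq0 /mean => /eqP; case: k => /= ->;
     rewrite !mulNr ?opprK.
have oppA k := opp A k trA; have oppB k := opp B k trB.
have sumf (D : bool -> 'M[C]_2) k : \tr (D true) + \tr (D false) = 0 ->
    frob2 (D true) + frob2 (D false)
    = 4 * `|mean (D k)| ^+ 2 + dev (D k) + dev (D (~~ k)).
  move=> trD.
  rewrite [LHS](_ : _ = frob2 (D k) + frob2 (D (~~ k))); last first.
    by case: (k) => //; rewrite addrC.
  by rewrite !frob2_dev (opp D k trD) normrN; ring.
rewrite (sumf A i trA) (sumf B j trB).
(* With [a] and [b] the means of [A i] and [B j], the parallelogram law turns the right-hand side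
   into [4 |a + b|^2 + 4 |a - b|^2] plus twice all four deviations. Each case leaves a visibly
   nonnegative remainder. *)
move: (sqr_norm_parallelogram (mean (A i)) (mean (B j))) => para.
have dA := dev_ge0 (A (~~ i)); have dB := dev_ge0 (B (~~ j)).
(* The weights of the Cauchy inequality in each case make a deviation common
   to both blocks count once in each bound. *)
have [z12|n12] := eqVneq (W2 i (~~ j)) 0; last first.
  have cauchy (x y z : C) : `|x + y + z| ^+ 2
      <= 4 * `|x| ^+ 2 + 2 * 1 * `|y| ^+ 2 + 2 * 2 * `|z| ^+ 2.
    rewrite (addrC x); apply: le_trans (sqr_normD3_le y x z) _.
    by rewrite le_eqVlt; apply/orP; left; apply/eqP; ring.
  have h1 := sylv_eigen_le (lexx 1) (ler1n _ 2) cauchy W1ij (e1 i j).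
  have h2 := sylv_eigen_le (lexx 1) (ler1n _ 2) cauchy n12 (e2 i (~~ j)).
  apply: le_trans (lerD h1 h2) _; rewrite oppB -subr_ge0.
  rewrite [X in 0 <= X](_ : _ = 2 * dev (A (~~ i))) ?mulr_ge0 //.
  move/eqP: para; rewrite eq_sym addrC -subr_eq => /eqP <-; ring.
have [z21|n21] := eqVneq (W2 (~~ i) j) 0; last first.
  have cauchy (x y z : C) : `|x + y + z| ^+ 2
      <= 4 * `|x| ^+ 2 + 2 * 2 * `|y| ^+ 2 + 2 * 1 * `|z| ^+ 2.
    rewrite addrC addrA; apply: le_trans (sqr_normD3_le z x y) _.
    by rewrite le_eqVlt; apply/orP; left; apply/eqP; ring.
  have h1 := sylv_eigen_le (ler1n _ 2) (lexx 1) cauchy W1ij (e1 i j).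
  have h2 := sylv_eigen_le (ler1n _ 2) (lexx 1) cauchy n21 (e2 (~~ i) j).
  apply: le_trans (lerD h1 h2) _; rewrite oppA -subr_ge0.
  rewrite (addrC (- _)) distrC.
  rewrite [X in 0 <= X](_ : _ = 2 * dev (B (~~ j))) ?mulr_ge0 //.
  move/eqP: para; rewrite eq_sym addrC -subr_eq => /eqP <-; ring.
(* In the opposite block both means change sign, so the two bounds share the same [|a + b|^2]. *)
have [z22|n22] := eqVneq (W2 (~~ i) (~~ j)) 0; last first.
  have cauchy (x y z : C) : `|x + y + z| ^+ 2
      <= 2 * `|x| ^+ 2 + 2 * 2 * `|y| ^+ 2 + 2 * 2 * `|z| ^+ 2.
    apply: le_trans (sqr_normD3_le x y z) _.
    by rewrite le_eqVlt; apply/orP; left; apply/eqP; ring.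
  have h1 := sylv_eigen_le (ler1n _ 2) (ler1n _ 2) cauchy W1ij (e1 i j).
  have h2 := sylv_eigen_le (ler1n _ 2) (ler1n _ 2) cauchy n22 (e2 (~~ i) (~~ j)).
  apply: le_trans (lerD h1 h2) _; rewrite oppA oppB -opprD normrN -subr_ge0.
  rewrite [X in 0 <= X](_ : _ = 4 * `|mean (A i) - mean (B j)| ^+ 2).
    by rewrite mulr_ge0 ?exprn_ge0.
  move/eqP: para; rewrite eq_sym -subr_eq => /eqP <-; ring.
(* Now [W2] lives on block [(i, j)] alone, so the global orthogonality becomes orthogonality within
   that block. *)
have n11 : W2 i j != 0.
  case: W2_0 z12 z21 z22 => i' [j']; move: i j i' j' {W1ij para dA dB}.
  by do 4!case => //=; move=> /eqP.
have {}orth : \tr (adjmx (W1 i j) *m W2 i j) = 0.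
  move: orth; rewrite !big_bool /=.
  by case: i z12 z21 z22 {W1ij para dA dB n11} => /=; case: j => /= -> -> ->;
     rewrite !mulmx0 !mxtrace0 !(addr0, add0r).
apply: le_trans (sylv_eigen_pair_le W1ij n11 orth (e1 i j) (e2 i j)) _.
rewrite -subr_ge0 [X in 0 <= X](_ : _ = 4 * `|mean (A i) - mean (B j)| ^+ 2
  + (2 * dev (A (~~ i)) + 2 * dev (B (~~ j)))).
  by rewrite !addr_ge0 ?mulr_ge0 ?exprn_ge0.
move/eqP: para; rewrite eq_sym -subr_eq => /eqP <-; ring.
Qed.

(** * Cutting a matrix into four blocks *)

Definition subblock m n (W : 'M[C]_(m + m, n + n)) (i j : bool) : 'M[C]_(m, n) :=
  if i then if j then ulsubmx W else ursubmx W
  else if j then dlsubmx W else drsubmx W.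

(** Block-diagonal coefficients never mix blocks: block [(i, j)] meets only the [i]-th block on the
    left and the [j]-th on the right. *)
Lemma sylv_eigen_subblock n (A1 A2 B1 B2 : 'M[C]_n) l W i j :
  sylv_eigen (block_mx A1 0 0 A2) (block_mx B1 0 0 B2) l W ->
  sylv_eigen (if i then A1 else A2) (if j then B1 else B2) l (subblock W i j).
Proof.
have sylv_block (D1 D2 E1 E2 V11 V12 V21 V22 : 'M[C]_n) :
    sylv (block_mx D1 0 0 D2) (block_mx E1 0 0 E2) (block_mx V11 V12 V21 V22)
    = block_mx (sylv D1 E1 V11) (sylv D1 E2 V12)
               (sylv D2 E1 V21) (sylv D2 E2 V22).
  rewrite /sylv tr_block_mx !mulmx_block !trmx0 !mulmx0 !mul0mx.
  by rewrite !addr0 !add0r add_block_mx.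
rewrite /sylv_eigen -{1 2}[W]submxK !adjmx_block !adjmx0 !sylv_block.
rewrite scale_block_mx => /eq_block_mx[e11 e12 e21 e22].
by case: i; case: j.
Qed.

Lemma mxdot_subblock n (W Z : 'M[C]_(n + n)) :
  \tr (adjmx W *m Z)
  = \sum_i \sum_j \tr (adjmx (subblock W i j) *m subblock Z i j).
Proof.
rewrite -[W in LHS]submxK -[Z in LHS]submxK adjmx_block mulmx_block.
rewrite mxtrace_block !mxtraceD !big_bool /=.
by rewrite addrACA.
Qed.

Lemma subblock_neq0 n (W : 'M[C]_(n + n)) : \tr (adjmx W *m W) = 1 ->
  exists i j, subblock W i j != 0.
Proof.
move=> W1; have [/existsP[i /existsP[j nz]]|z] :=
  boolP [exists i, exists j, subblock W i j != 0]; first by exists i, j.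
suff : 1 = 0 :> C by move/eqP; rewrite oner_eq0.
rewrite -W1 mxdot_subblock big1 // => i _; rewrite big1 // => j _.
move/existsPn/(_ i)/existsPn/(_ j): z; rewrite negbK => /eqP->.
by rewrite mulmx0 mxtrace0.
Qed.

End KroneckerSum.

Theorem theorem1 (R : rcfType) (A B : 'M[R[i]]_4) :
  \tr A = 0 -> \tr B = 0 ->
  frob2 A + frob2 B = 1 / 4 ->
  (exists (U : 'M[R[i]]_4) (A11 A22 : 'M[R[i]]_2),
      unitary U /\ U *m A *m adjmx U = block_mx A11 0 0 A22) ->
  (exists (V : 'M[R[i]]_4) (B11 B22 : 'M[R[i]]_2),
      unitary V /\ V *m B *m adjmx V = block_mx B11 0 0 B22) ->
  let X : 'M[R[i]]_(4 * 4) := kron A (1%:M : 'M_4) + kron (1%:M : 'M_4) B in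
  sigma X 1 ^+ 2 + sigma X 2 ^+ 2 <= 1 / 2.
Proof.
move=> trA trB frobAB [U [A1 [A2 [uU eA]]]] [V [B1 [B2 [uV eB]]]] /=.
set X := kron _ _ + _.
have [u [v [uu vv uv eu ev]]] := @sigma_eigenvectors _ _ X isT.
(* Rotation to the bases in which [A] and [B] are block-diagonal; the type [2 + 2], convertible to
   4, exposes the blocks. *)
pose rot (w : 'cV[R[i]]_(4 * 4)) : 'M[R[i]]_(2 + 2) := U *m unvecm w *m V^T.
have dot w z : \tr (adjmx (rot w) *m rot z) = \tr (adjmx w *m z).
  have VV : V^T *m adjmx V^T = 1%:M.
    by rewrite adjmx_tr -trmx_mul unitaryV ?trmx1.
  rewrite /rot !adjmxM -!mulmxA (mulmxA (adjmx U)) unitaryV // mul1mx.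
  rewrite mxtrace_mulC -!mulmxA VV mulmx1.
  by rewrite -[LHS]mxdot_vecm !unvecmK.
have eig l w : adjmx X *m X *m w = l *: w ->
    sylv_eigen (block_mx A1 0 0 A2) (block_mx B1 0 0 B2) l (rot w).
  by move=> /ksum_eigen e; rewrite -eA -eB; apply: sylv_eigen_unitary.
have trA' : \tr A1 + \tr A2 = 0.
  rewrite -trA -(mxtrace_conj_unitary A uU) eA.
  exact: esym (mxtrace_block _ 0 0 _).
have trB' : \tr B1 + \tr B2 = 0.
  rewrite -trB -(mxtrace_conj_unitary B uV) eB.
  exact: esym (mxtrace_block _ 0 0 _).
have fA : frob2 A1 + frob2 A2 = frob2 A.
  rewrite -(frob2_mul_unitary A uU (unitary_adj uU)) eA.
  exact: esym (frob2_block_diag _ _).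
have fB : frob2 B1 + frob2 B2 = frob2 B.
  rewrite -(frob2_mul_unitary B uV (unitary_adj uV)) eB.
  exact: esym (frob2_block_diag _ _).
have := @two_blocks_le _ (fun i => if i then A1 else A2)
  (fun j => if j then B1 else B2) (subblock (rot u)) (subblock (rot v))
  (sigma X 1 ^+ 2) (sigma X 2 ^+ 2) trA' trB'
  (fun i j => sylv_eigen_subblock i j (eig _ _ eu))
  (fun i j => sylv_eigen_subblock i j (eig _ _ ev)).
rewrite -mxdot_subblock /= dot fA fB frobAB => /(_ _ _ uv).
rewrite (_ : 2 * (1 / 4) = 1 / 2) => [|]; last by field.
by apply; apply: subblock_neq0; rewrite dot.
Qed.
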